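(* Let $w \in F$ be an element of Thompson's group $F$, represented by its reduced tree pair diagram $(T_-,T_+)$, in which each of the two trees has $N(w)$ carets. Then $$N(w)-2 \;\leq\; |w| \;\leq\; 4N(w)-4,$$ where $|w|$ denotes the word length of $w$ with respect to the generating set $\{x_0,x_1\}$.
   Context: Thompson's group $F$ is the group with infinite presentation $\langle x_k,\ k\ge 0 \mid x_i^{-1}x_jx_i=x_{j+1}\ \text{for } i<j\rangle$; it is generated by $x_0,x_1$, with finite presentation $\langle x_0,x_1\mid [x_0x_1^{-1},x_0^{-1}x_1x_0],[x_0x_1^{-1},x_0^{-2}x_1x_0^2]\rangle$. $|w|$ denotes word length with respect to $\{x_0^{\pm1},x_1^{\pm1}\}$. Tree pair diagrams: A tree is a finite rooted binary tree in which every vertex has either no children or two (left and right) children. A caret is a non-leaf node together with its two downward edges. The exposed leaves of a tree are numbered from left to right starting with $0$. A tree pair diagram $(T_-,T_+)$ is a pair of such trees with the same number of carets; every tree has at least one caret. The pair is unreduced if, for some $m$, both $T_-$ and $T_+$ contain a caret both of whose leaves are exposed, with leaf numbers $m$ and $m+1$; deleting that caret in both trees gives another diagram for the same element. Each nontrivial element of $F$ has a unique reduced tree pair diagram; the identity is represented by the pair of single-caret trees. Correspondence with elements: the right side of a tree is the maximal path of right edges starting at the root (including the root). For an exposed leaf $k$ the exponent $E(k)$ is the length of the maximal upward path from leaf $k$ consisting only of left edges and not reaching the right side of the tree ($E(k)=0$ if leaf $k$ is a right leaf). The pair $(T_-,T_+)$ with leaves $0,\dots,m$ represents the element $x_0^{E_+(0)}x_1^{E_+(1)}\cdots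 x_m^{E_+(m)}\,x_m^{-E_-(m)}\cdots x_1^{-E_-(1)}x_0^{-E_-(0)}$, where $E_\pm$ are the exponents computed in $T_\pm$. *)

(* Defs.v *)
From HB Require Import structures.
From mathcomp Require Import all_boot.
From mathcomp Require Import generic_quotient boolp.

Set Implicit Arguments.
Unset Strict Implicit.
Unset Printing Implicit Defensive.

Import Algebra.
Local Open Scope group_scope.
Local Open Scope quotient_scope.

(* Thompson's group F, from its infinite presentation:
   the quotient of the free monoid on the letters [x_k] and [x_k^-1] by
   the smallest congruence containing free reduction and the relators
   [x_i^-1 x_j x_i = x_(j+1)], [i < j]. *)

(* [(k, false)] stands for [x_k] and [(k, true)] for [x_k^-1]. *)
Definition letter : Type := (nat * bool)%type.

Definition inv_letter (l : letter) : letter := (l.1, ~~ l.2).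

Definition inv_word (u : seq letter) : seq letter := rev (map inv_letter u).

Inductive F_cong : seq letter -> seq letter -> Prop :=
| F_cong_refl u : F_cong u u
| F_cong_sym u v : F_cong u v -> F_cong v u
| F_cong_trans v u w : F_cong u v -> F_cong v w -> F_cong u w
| F_cong_cat u u' v v' : F_cong u u' -> F_cong v v' -> F_cong (u ++ v) (u' ++ v')
| F_cong_free l : F_cong [:: l; inv_letter l] [::]
| F_cong_rel i j : (i < j)%N ->
    F_cong [:: (i, true); (j, false); (i, false)] [:: (j.+1, false)].

Definition F_rel : rel (seq letter) := fun u v => `[< F_cong u v >].

Lemma F_relP u v : reflect (F_cong u v) (F_rel u v).
Proof. exact: asboolP. Qed.

Lemma F_rel_refl : reflexive F_rel.
Proof. by move=> u; apply/F_relP; apply: F_cong_refl. Qed.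

Lemma F_rel_sym : symmetric F_rel.
Proof. by move=> u v; apply/F_relP/F_relP; apply: F_cong_sym. Qed.

Lemma F_rel_trans : transitive F_rel.
Proof.
by move=> v u w /F_relP uv /F_relP vw; apply/F_relP; apply: F_cong_trans uv vw.
Qed.

Canonical F_equiv := EquivRel F_rel F_rel_refl F_rel_sym F_rel_trans.

Definition thompsonF : Type := {eq_quot F_equiv}.
HB.instance Definition _ := Choice.on thompsonF.
HB.instance Definition _ := EqQuotient.on thompsonF.

Definition classF (u : seq letter) : thompsonF := (\pi_thompsonF u)%qT.

Lemma classFP u v : classF u = classF v <-> F_cong u v.
Proof. by split=> [/eqmodP/F_relP|/F_relP/eqmodP]. Qed.

Lemma classF_repr (a : thompsonF) : classF (repr a) = a.
Proof. exact: reprK. Qed.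

Lemma inv_letterK : involutive inv_letter.
Proof. by case=> k b; rewrite /inv_letter /= negbK. Qed.

Lemma inv_word_cat u v : inv_word (u ++ v) = inv_word v ++ inv_word u.
Proof. by rewrite /inv_word map_cat rev_cat. Qed.

Lemma inv_wordK : involutive inv_word.
Proof.
by move=> u; rewrite /inv_word map_rev revK -map_comp map_id_in // => l _ /=;
  rewrite inv_letterK.
Qed.

Lemma F_cong_mulV u : F_cong (u ++ inv_word u) [::].
Proof.
elim: u => [|l u IHu]; first exact: F_cong_refl.
rewrite -cat1s inv_word_cat -catA [u ++ _]catA.
apply: F_cong_trans (F_cong_free l).
apply: (@F_cong_cat [:: l] [:: l]); first exact: F_cong_refl.
exact: F_cong_cat IHu (F_cong_refl _).
Qed.

Lemma F_cong_Vmul u : F_cong (inv_word u ++ u) [::].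
Proof. by have := F_cong_mulV (inv_word u); rewrite inv_wordK. Qed.

Lemma F_cong_inv u v : F_cong u v -> F_cong (inv_word u) (inv_word v).
Proof.
move=> uv.
apply: (@F_cong_trans (inv_word u ++ v ++ inv_word v)).
  rewrite -{1}[inv_word u]cats0; apply: F_cong_cat; first exact: F_cong_refl.
  exact/F_cong_sym/F_cong_mulV.
rewrite catA -[in X in F_cong _ X](cat0s (inv_word v)).
apply: F_cong_cat; last exact: F_cong_refl.
apply: F_cong_trans (F_cong_Vmul u).
by apply: F_cong_cat; [apply: F_cong_refl | apply: F_cong_sym].
Qed.

Definition mulF := lift_op2 thompsonF (@cat letter).
Definition invF := lift_op1 thompsonF inv_word.
Definition oneF : thompsonF := classF [::].

Lemma F_cong_repr u : F_cong (repr (classF u)) u.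
Proof. exact/classFP/classF_repr. Qed.

Lemma mulF_class u v : mulF (classF u) (classF v) = classF (u ++ v).
Proof. by rewrite /mulF -lock; apply/classFP/F_cong_cat; apply: F_cong_repr. Qed.

Lemma invF_class u : invF (classF u) = classF (inv_word u).
Proof. by rewrite /invF -lock; apply/classFP/F_cong_inv/F_cong_repr. Qed.

Lemma mulFA : associative mulF.
Proof.
move=> a b c; rewrite -[a]classF_repr -[b]classF_repr -[c]classF_repr.
by rewrite !mulF_class catA.
Qed.

Lemma mul1F : left_id oneF mulF.
Proof. by move=> a; rewrite -[a]classF_repr mulF_class. Qed.

Lemma mulF1 : right_id oneF mulF.
Proof. by move=> a; rewrite -[a]classF_repr mulF_class cats0. Qed.

Lemma mulVF : left_inverse oneF invF mulF.
Proof.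
move=> a; rewrite -[a]classF_repr invF_class mulF_class.
exact/classFP/F_cong_Vmul.
Qed.

Lemma mulFV : right_inverse oneF invF mulF.
Proof.
move=> a; rewrite -[a]classF_repr invF_class mulF_class.
exact/classFP/F_cong_mulV.
Qed.

HB.instance Definition _ := isGroup.Build thompsonF mulFA mul1F mulF1 mulVF mulFV.

Definition xF (k : nat) : thompsonF := classF [:: (k, false)].

Lemma mulFE u v : classF u * classF v = classF (u ++ v).
Proof. exact: mulF_class. Qed.

Lemma invFE u : (classF u)^-1 = classF (inv_word u).
Proof. exact: invF_class. Qed.

Lemma xF_rel i j : (i < j)%N -> (xF i)^-1 * xF j * xF i = xF j.+1.
Proof.
move=> ij; rewrite /xF invFE mulFE mulFE; apply/classFP.
exact: (F_cong_rel ij).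
Qed.

Definition gens01 : seq thompsonF := [:: xF 0; (xF 0)^-1; xF 1; (xF 1)^-1].

Definition is_word01 (w : thompsonF) (n : nat) : Prop :=
  exists s : seq thompsonF,
    [/\ size s = n, {subset s <= gens01} & w = \prod_(g <- s) g].

Definition gen_by01 (w : thompsonF) : Prop := exists n, is_word01 w n.

Lemma gen_by01_gen w : w \in gens01 -> gen_by01 w.
Proof.
move=> gw; exists 1%N, [:: w]; split; rewrite ?big_seq1 //.
by move=> g; rewrite inE => /eqP->.
Qed.

Lemma gen_by01_mul v w : gen_by01 v -> gen_by01 w -> gen_by01 (v * w).
Proof.
move=> [_ [s [_ gs ->]]] [_ [t [_ gt ->]]].
exists (size s + size t)%N, (s ++ t); split; rewrite ?size_cat ?big_cat //.
by move=> g; rewrite mem_cat => /orP[/gs|/gt].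
Qed.

Lemma gen_by01_x k : gen_by01 (xF k) /\ gen_by01 (xF k)^-1.
Proof.
have g0 : gen_by01 (xF 0) by apply: gen_by01_gen; rewrite !inE eqxx.
have g0V : gen_by01 (xF 0)^-1 by apply: gen_by01_gen; rewrite !inE eqxx ?orbT.
case: k => // k; elim: k => [|k [IHk IHkV]].
  by split; apply: gen_by01_gen; rewrite !inE eqxx ?orbT.
rewrite -(@xF_rel 0 k.+1) // !invgM invgK.
by split; do ?apply: gen_by01_mul.
Qed.

Lemma ex_is_word01 w : exists n, `[< is_word01 w n >].
Proof.
suff [n wn] : gen_by01 w by exists n; apply/asboolP.
rewrite -[w]classF_repr; elim: (repr w) => [|[k b] u IHu].
  by exists 0%N, [::]; split=> //; rewrite big_nil.
rewrite -cat1s -mulFE; apply: gen_by01_mul => //.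
have [xk xkV] := gen_by01_x k; case: b => //.
by move: xkV; rewrite invFE.
Qed.

Definition word_length (w : thompsonF) : nat := ex_minn (ex_is_word01 w).

Inductive tree := Leaf | Caret of tree & tree.

Fixpoint ncarets (t : tree) : nat :=
  if t is Caret l r then (ncarets l + ncarets r).+1 else 0.

Definition nleaves (t : tree) : nat := (ncarets t).+1.

(* Exponents, from left to right, of the leaves of a subtree disjoint from the
   right side; [d] is the length of the maximal path of left edges going up
   from the root of that subtree and not reaching the right side. *)
Fixpoint inner_exponents (d : nat) (t : tree) : seq nat :=
  if t is Caret l r then inner_exponents d.+1 l ++ inner_exponents 0 r
  else [:: d].

(* Exponents of the leaves of a tree whose root is on the right side: the left
   edge below such a root reaches the right side, so it is not counted. *)
Fixpoint exponents (t : tree) : seq nat :=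
  if t is Caret l r then inner_exponents 0 l ++ exponents r else [:: 0%N].

Definition leaf_exp (t : tree) (k : nat) : nat := nth 0%N (exponents t) k.

(* [exposed_caret t m]: leaves [m] and [m + 1] of [t] are the two leaves of one
   caret. *)
Fixpoint exposed_caret (t : tree) (m : nat) : bool :=
  match t with
  | Leaf => false
  | Caret Leaf Leaf => m == 0%N
  | Caret l r => exposed_caret l m ||
                 (nleaves l <= m)%N && exposed_caret r (m - nleaves l)%N
  end.

Record tree_pair := TreePair {
  tminus : tree;
  tplus : tree;
  tminus_gt0 : (0 < ncarets tminus)%N;
  tree_pair_carets : ncarets tminus = ncarets tplus
}.

Definition pair_carets (D : tree_pair) : nat := ncarets (tminus D).

(* Trees have at least one caret, so the pair of single-caret trees, which
   represents the identity, is reduced even though the carets match. *)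
Definition reduced (D : tree_pair) : Prop :=
  (1 < pair_carets D)%N ->
  ~ exists m, exposed_caret (tminus D) m /\ exposed_caret (tplus D) m.

Definition pair_elt (D : tree_pair) : thompsonF :=
  let leaves := iota 0 (pair_carets D).+1 in
  \prod_(k <- leaves) (xF k ^+ leaf_exp (tplus D) k) *
  \prod_(k <- rev leaves) (xF k ^- leaf_exp (tminus D) k).

(* Main.v *)
(* Upper bound: since x_(k+1) = x_0^-1 x_k x_0 for k > 0, the positive word of a
   tree telescopes to x_0^E(0) x_1^E(1) x_0^-1 x_1^E(2) x_0^-1 ..., followed by
   a power of x_0 that depends only on the number of carets and hence cancels
   between the two trees.

   Lower bound: F acts on infinite binary sequences, and the element of (T, U)
   replaces each leaf address of T by the corresponding leaf address of U.
   Multiplying by a generator rotates U near its root, after adding at most one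
   caret to both trees; starting from two carets, an element of length n is
   thus realized by a pair with at most n + 2 carets. A reduced pair has the
   fewest carets among the pairs (T, U) realizing a map: otherwise two sibling
   leaves of its first tree lie below a single leaf of T, so their images are
   sibling leaves as well, and the pair is not reduced. *)
Require Import Defs.
From mathcomp Require Import all_boot all_order ssralg ssrnum ssrint.
From mathcomp Require Import boolp zify.

Section Thompson.

Set Implicit Arguments.
Unset Strict Implicit.
Unset Printing Implicit Defensive.

Import Algebra.
Local Open Scope nat_scope.

(** * Action of Thompson's group on infinite binary sequences *)

Definition bits := nat -> bool.

Definition scons (b : bool) (s : bits) : bits :=
  fun n => if n is n'.+1 then s n' else b.

Definition stail (s : bits) : bits := fun n => s n.+1.

Lemma scons_ind (P : bits -> Prop) :
  (forall b s, P (scons b s)) -> forall s, P s.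
Proof.
move=> Pcons s; suff -> : s = scons (s 0) (stail s) by [].
by apply: funext => -[].
Qed.

Lemma scons_inj b c s t : scons b s = scons c t -> b = c /\ s = t.
Proof.
move=> st; split; first by have := congr1 (@^~ 0) st.
by apply: funext => n; have := congr1 (@^~ n.+1) st.
Qed.

Definition scat (p : seq bool) (s : bits) : bits := foldr scons s p.

Lemma scat_cat p q : scat (p ++ q) = scat p \o scat q.
Proof. by apply: funext => s; rewrite /scat foldr_cat. Qed.

Lemma scat_inj : injective scat.
Proof.
(* The constant sequence of value [~~ b] separates the two maps at position 0. *)
have neq b p : scat [::] <> scat (b :: p).
  by move=> /(congr1 (fun f => f (fun=> ~~ b) 0)) /=; case: b.
elim=> [|b p IHp] [|c q] // => [/neq | /esym/neq | pq] //.
have /= pqs s := scons_inj (congr1 (@^~ s) pq).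
have [-> _] := pqs xpred0; congr (_ :: _).
by apply: IHp; apply: funext => s; have [] := pqs s.
Qed.

(* 0s, 10s and 11s go to 00s, 01s and 1s: the action of [x_0]; that of [x_k] is
   the same rotation below the address 1^k. *)
Definition rot0 (s : bits) : bits :=
  if s 0 then if s 1 then stail s
              else scons false (scons true (stail (stail s)))
  else scons false s.

Definition rot0V (s : bits) : bits :=
  if s 0 then scons true s
  else if s 1 then scons true (scons false (stail (stail s)))
  else stail s.

Definition on_right (g : bits -> bits) (s : bits) : bits :=
  if s 0 then scons true (g (stail s)) else s.

Lemma rot0K : cancel rot0 rot0V.
Proof.
elim/scons_ind => -[] s; last by [].
by elim/scons_ind: s => -[] s.
Qed.

Lemma rot0VK : cancel rot0V rot0.
Proof.
elim/scons_ind => -[] s; first by [].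
by elim/scons_ind: s => -[] s.
Qed.

Lemma on_right_comp g h : on_right (g \o h) = on_right g \o on_right h.
Proof. by apply: funext; elim/scons_ind => -[] s. Qed.

Lemma on_right_id : on_right id = id.
Proof. by apply: funext; elim/scons_ind => -[] s. Qed.

Lemma on_rightK g h : cancel g h -> cancel (on_right g) (on_right h).
Proof.
move=> gK; elim/scons_ind => -[] s; last by [].
exact: (congr1 (scons true) (gK s)).
Qed.

Definition act_letter (l : letter) : bits -> bits :=
  iter l.1 on_right (if l.2 then rot0V else rot0).

Lemma act_letterK l : cancel (act_letter (inv_letter l)) (act_letter l).
Proof.
case: l => k b; rewrite /act_letter /=.
elim: k => [|k IHk] /=; last exact: on_rightK.
by case: b; [apply: rot0K | apply: rot0VK].
Qed.

(** Removing common [on_right] layers reduces to [i = 0], where it holds because [rot0] carries the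
    cone below 11 to the cone below 1. *)
Lemma act_letter_comm i j : i < j ->
  act_letter (j, false) \o act_letter (i, false)
  = act_letter (i, false) \o act_letter (j.+1, false).
Proof.
elim: i j => [|i IHi] [|j] // ij.
  apply: funext; elim/scons_ind => -[] s; last by [].
  by elim/scons_ind: s => -[] s.
have := congr1 on_right (IHi j ij).
by rewrite (on_right_comp (act_letter (j, _))) (on_right_comp (act_letter (i, _))).
Qed.

Definition act_word (u : seq letter) : bits -> bits :=
  foldr (fun l g => act_letter l \o g) id u.

Lemma act_word_cat u v : act_word (u ++ v) = act_word u \o act_word v.
Proof. by elim: u => //= l u ->. Qed.

Lemma F_cong_act u v : F_cong u v -> act_word u = act_word v.
Proof.
elim=> //= [{}u {}v w _ -> _ -> | {}u u' {}v v' _ eu _ ev | l | i j ij] //.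
- by rewrite !act_word_cat eu ev.
- by apply: funext => s; apply: act_letterK.
- apply: funext => s; apply: etrans (act_letterK (i, true) _).
  by have /(congr1 (fun f => act_letter (i, true) (f s))) := act_letter_comm ij.
Qed.

Definition act (w : thompsonF) : bits -> bits := act_word (repr w).

Lemma act_class u : act (classF u) = act_word u.
Proof. exact/F_cong_act/F_cong_repr. Qed.

Lemma act1 : act 1%g = id.
Proof. exact: act_class. Qed.

Lemma actM v w : act (v * w)%g = act v \o act w.
Proof.
by rewrite -[v]classF_repr -[w]classF_repr mulFE !act_class act_word_cat.
Qed.

Lemma act_x k : act (xF k) = iter k on_right rot0.
Proof. exact: act_class. Qed.

Lemma act_xV k : act (xF k)^-1%g = iter k on_right rot0V.
Proof. by rewrite invFE act_class. Qed.

Lemma actK w : cancel (act w) (act w^-1%g).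
Proof. by move=> s; have := congr1 (@^~ s) (actM w^-1%g w); rewrite mulVg act1. Qed.

(** * Leaf addresses, maps realized by tree pairs, and grafting *)

Fixpoint leaves (t : tree) : seq (seq bool) :=
  if t is Caret l r
  then map (cons false) (leaves l) ++ map (cons true) (leaves r)
  else [:: [::]].

Lemma size_leaves t : size (leaves t) = nleaves t.
Proof. by elim: t => //= l IHl r IHr; rewrite size_cat !size_map IHl IHr addnS. Qed.

(* [g] maps the cone below each leaf of [t] to the cone below the leaf of [u]
   with the same number, preserving the remaining bits. *)
Definition rep (g : bits -> bits) (t u : tree) :=
  [seq g \o scat p | p <- leaves t] = map scat (leaves u).

Lemma rep_nleaves g t u : rep g t u -> ncarets t = ncarets u.
Proof. by move=> /(congr1 size); rewrite !size_map !size_leaves => -[]. Qed.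

Lemma rep_nth g t u m : rep g t u -> m < nleaves t ->
  g \o scat (nth [::] (leaves t) m) = scat (nth [::] (leaves u) m).
Proof.
move=> gtu mt; have /(congr1 (fun fs => nth id fs m)) := gtu.
by rewrite !(nth_map [::]) ?size_leaves // /nleaves -(rep_nleaves gtu).
Qed.

Lemma rep_comp g h t u v : rep g t u -> rep h u v -> rep (h \o g) t v.
Proof.
rewrite /rep => gtu <-.
by rewrite (map_comp (fun f => h \o f) scat) -gtu -map_comp.
Qed.

Lemma rep_cancel g h t u : cancel g h -> rep g t u -> rep h u t.
Proof.
rewrite /rep => gK gtu.
rewrite (map_comp (fun f => h \o f) scat) -gtu -map_comp.
by apply: eq_map => p; apply: funext => s /=; rewrite gK.
Qed.

Lemma rep_on_right g a t u :
  rep g t u -> rep (on_right g) (Caret a t) (Caret a u).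
Proof.
rewrite /rep /= !map_cat -!map_comp => gtu; congr (_ ++ _).
rewrite (map_comp (fun f => scons true \o f) scat) -gtu -map_comp.
exact: eq_map.
Qed.

Lemma rep_rot0 a b c : rep rot0 (Caret a (Caret b c)) (Caret (Caret a b) c).
Proof. by rewrite /rep /= !map_cat catA -!map_comp. Qed.

Lemma rep_rot0V a b c : rep rot0V (Caret (Caret a b) c) (Caret a (Caret b c)).
Proof. exact: rep_cancel rot0K (rep_rot0 a b c). Qed.

Fixpoint graft (m : nat) (t u : tree) : tree :=
  if t is Caret l r then
    if m < nleaves l then Caret (graft m l u) r
    else Caret l (graft (m - nleaves l) r u)
  else u.

Lemma leaves_graft m t u : m < nleaves t ->
  leaves (graft m t u) =
  take m (leaves t) ++ map (cat (nth [::] (leaves t) m)) (leaves u)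
    ++ drop m.+1 (leaves t).
Proof.
elim: t m => [|l IHl r IHr] m mt.
  by case: m mt => //= _; rewrite cats0 map_id.
rewrite /=; case: ltnP => lm /=.
  rewrite IHl // !map_cat take_cat drop_cat nth_cat size_map size_leaves lm.
  rewrite (nth_map [::]) ?size_leaves // map_take -!catA.
  congr (_ ++ (_ ++ _)); first by rewrite -map_comp.
  case: ltnP => lm'; first by rewrite map_drop.
  have -> : m.+1 = nleaves l by apply/eqP; rewrite eqn_leq lm lm'.
  by rewrite subnn drop0 drop_oversize // size_leaves.
have mr : m - nleaves l < nleaves r by move: mt lm; rewrite /nleaves /=; lia.
rewrite IHr // !map_cat take_cat drop_cat nth_cat size_map size_leaves.
rewrite (ltnNge m) (ltnNge m.+1) lm ltnW ?ltnS //= (nth_map [::]) ?size_leaves //.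
by rewrite map_take map_drop -catA subSn // -map_comp.
Qed.

(** The inverse of reduction: below leaf [m] only the prefix changes under [g], so any common
    subdivision [v] of the two cones is respected. *)
Lemma rep_graft g t u m v : m < nleaves t ->
  rep g t u -> rep g (graft m t v) (graft m u v).
Proof.
move=> mt gtu; have mu : m < nleaves u by rewrite /nleaves -(rep_nleaves gtu).
have gm := rep_nth gtu mt.
rewrite /rep !leaves_graft // !map_cat !map_take !map_drop gtu -!map_comp.
congr (_ ++ (_ ++ _)); apply: eq_map => p /=.
by rewrite !scat_cat -gm.
Qed.

Lemma ncarets_graft m t u : m < nleaves t ->
  ncarets (graft m t u) = ncarets t + ncarets u.
Proof.
elim: t m => [|l IHl r IHr] m //=; rewrite /nleaves /= => mt.
by case: ltnP => lm /=; rewrite ?IHl ?IHr /nleaves; lia.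
Qed.

(** The tree whose carets all lie on the right side has only zero exponents. The map of a tree pair
    factors through it: the negative half of the word leads from [tminus] to the spine, the positive
    half from there to [tplus]. *)
Fixpoint spine (n : nat) : tree :=
  if n is n'.+1 then Caret Leaf (spine n') else Leaf.

Lemma ncarets_spine n : ncarets (spine n) = n.
Proof. by elim: n => //= n ->. Qed.

Lemma graft_spine m n : graft m (spine m) (spine n) = spine (m + n).
Proof. by elim: m => //= m IHm; rewrite subn1 /= IHm. Qed.

Lemma rep_iter_on_right g k t u :
  rep g t u -> rep (iter k on_right g) (graft k (spine k) t) (graft k (spine k) u).
Proof.
by move=> gtu; elim: k => //= k IHk; rewrite subn1; apply: rep_on_right.
Qed.

(** * Growth of the number of carets with word length *)

Lemma graft_last a b u :
  graft (ncarets a + (ncarets b + 0).+1).+1 (Caret a (Caret b Leaf)) u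
  = Caret a (Caret b u).
Proof. by rewrite /= /nleaves; do !case: ifP => [|_]; try lia. Qed.

(** The shape of the second tree is the invariant that makes every rotation cost at most one caret.
    To rotate and keep the shape, [c] must be a caret for [x_0] and [x_1], [a] for the inverse of
    [x_0], and [b] for the inverse of [x_1]. If it is a leaf, one caret is grafted there. *)
Lemma rep_ncarets_growth (ws : seq thompsonF) : {subset ws <= gens01} ->
  exists t a b c,
    rep (act (\prod_(g <- ws) g)%g) t (Caret a (Caret b c))
    /\ ncarets t <= size ws + 2.
Proof.
elim: ws => [|g ws IHws] gens.
  exists (spine 2), Leaf, Leaf, Leaf.
  by rewrite big_nil act1.
have [|t [a [b [c [abc tn]]]]] := IHws.
  by move=> h ws_h; apply: gens; rewrite inE ws_h orbT.
have gen_g : g \in gens01 by apply: gens; rewrite inE eqxx.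
set h := act _ in abc.
have split_leaf m : m < nleaves t -> exists2 t',
    rep h t' (graft m (Caret a (Caret b c)) (Caret Leaf Leaf))
    & ncarets t' <= size ws + 3.
  move=> mt; exists (graft m t (Caret Leaf Leaf)); first exact: rep_graft.
  by rewrite ncarets_graft //= addn1 [_ + 3]addnS ltnS.
have tE : ncarets t = (ncarets a + (ncarets b + ncarets c).+1).+1 := rep_nleaves abc.
have done t' a' b' c' : rep (act g \o h) t' (Caret a' (Caret b' c')) ->
    ncarets t' <= size ws + 3 ->
  exists t a b c,
    rep (act (\prod_(x <- g :: ws) x)%g) t (Caret a (Caret b c))
    /\ ncarets t <= size (g :: ws) + 2.
  by move=> gh tn'; exists t', a', b', c'; rewrite big_cons actM addSnnS.
have tn' : ncarets t <= size ws + 3 by rewrite (leq_trans tn) // leq_add2l.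
move: gen_g done; rewrite !inE => /or4P[] /eqP-> done.
- rewrite act_x in done.
  case: c abc tE done split_leaf => [|c d] abc tE done split_leaf; last first.
    exact: done (rep_comp abc (rep_rot0 _ _ _)) tn'.
  (* The leaf [c] is the last one, so its number is the caret count; [graft_last] has this number in
     the form given by [tE]. *)
  have [|t' gt' t'n] := split_leaf (ncarets t); first exact: leqnn.
  rewrite tE graft_last in gt'.
  exact: done (rep_comp gt' (rep_rot0 _ _ _)) t'n.
- rewrite act_xV in done.
  case: a abc tE done split_leaf => [|a d] abc tE done split_leaf; last first.
    exact: done (rep_comp abc (rep_rot0V _ _ _)) tn'.
  have [|t' gt' t'n] := split_leaf 0; first by [].
  exact: done (rep_comp gt' (rep_rot0V _ _ _)) t'n.
- rewrite act_x in done.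
  case: c abc tE done split_leaf => [|c d] abc tE done split_leaf; last first.
    exact: done (rep_comp abc (rep_on_right _ (rep_rot0 _ _ _))) tn'.
  have [|t' gt' t'n] := split_leaf (ncarets t); first exact: leqnn.
  rewrite tE graft_last in gt'.
  exact: done (rep_comp gt' (rep_on_right _ (rep_rot0 _ _ _))) t'n.
- rewrite act_xV in done.
  case: b abc tE done split_leaf => [|b d] abc tE done split_leaf; last first.
    exact: done (rep_comp abc (rep_on_right _ (rep_rot0V _ _ _))) tn'.
  have [|t' gt' t'n] := split_leaf (nleaves a); first by rewrite /nleaves tE; lia.
  rewrite /= ltnn subnn /= in gt'.
  exact: done (rep_comp gt' (rep_on_right _ (rep_rot0V _ _ _))) t'n.
Qed.

(** * Minimality of reduced pairs *)

Lemma nth_leavesl l r m : m < nleaves l ->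
  nth [::] (leaves (Caret l r)) m = false :: nth [::] (leaves l) m.
Proof.
by move=> ml; rewrite /= nth_cat size_map size_leaves ml (nth_map [::]) ?size_leaves.
Qed.

Lemma nth_leavesr l r m : m < nleaves r ->
  nth [::] (leaves (Caret l r)) (nleaves l + m) = true :: nth [::] (leaves r) m.
Proof.
move=> mr; rewrite /= nth_cat size_map size_leaves ltnNge leq_addr addKn /=.
by rewrite (nth_map [::]) ?size_leaves.
Qed.

Lemma nleaves_Caret l r : nleaves (Caret l r) = nleaves l + nleaves r.
Proof. by rewrite /nleaves /= addnS. Qed.

Lemma leaf_siblings t : 0 < ncarets t -> exists p m,
  [/\ m.+1 < nleaves t, nth [::] (leaves t) m = rcons p false
    & nth [::] (leaves t) m.+1 = rcons p true].
Proof.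
elim: t => // l IHl r IHr _.
case: (posnP (ncarets r)) => [r0 | /IHr[p [m [mr p0 p1]]]]; last first.
  exists (true :: p), (nleaves l + m).
  rewrite -addnS !nth_leavesr ?(ltnW mr) // p0 p1 nleaves_Caret.
  by rewrite ltn_add2l.
case: (posnP (ncarets l)) => [l0 | /IHl[p [m [ml p0 p1]]]].
  by exists [::], 0; case: l r l0 r0 {IHl IHr} => [|//] [|//].
exists (false :: p), m.
rewrite !nth_leavesl ?(ltnW ml) // p0 p1 nleaves_Caret.
by rewrite ltn_addr.
Qed.

Lemma root_leaf t m : m < nleaves t -> nth [::] (leaves t) m = [::] -> t = Leaf.
Proof.
case: t => // l r; rewrite nleaves_Caret => mt.
have [ml | lm] := ltnP m (nleaves l); first by rewrite nth_leavesl.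
by rewrite -(subnKC lm) nth_leavesr // -(ltn_add2l (nleaves l)) subnKC.
Qed.

Lemma leaf_siblings_exposed t m p : m.+1 < nleaves t ->
  nth [::] (leaves t) m = rcons p false ->
  nth [::] (leaves t) m.+1 = rcons p true -> exposed_caret t m.
Proof.
elim: t m p => // l IHl r IHr m p mt p0 p1.
have exposedE : exposed_caret (Caret l r) m =
    if (ncarets l == 0) && (ncarets r == 0) then m == 0
    else exposed_caret l m
      || (nleaves l <= m) && exposed_caret r (m - nleaves l).
  by case: (l) (r) => [|? ?] [|? ?].
have [lm | ml] := leqP (nleaves l) m.
  move: mt p0 p1 exposedE; rewrite -{1 2 3}(subnKC lm) -addnS nleaves_Caret ltn_add2l.
  move: (m - nleaves l) => k kr; rewrite !nth_leavesr ?(ltnW kr) // => p0 p1 ->.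
  case: p p0 p1 => [|[] p] // [p0] [p1].
  have r_k := IHr _ _ kr p0 p1.
  have r_gt0 : 0 < ncarets r by case: (r) r_k.
  by rewrite (gtn_eqF r_gt0) andbF r_k lm orbT.
(* If the two leaves straddle the root, their addresses start with different bits, so [p] is empty
   and both children are leaves. *)
have [lSm | Sml] := leqP (nleaves l) m.+1.
  have Sm : nleaves l = m.+1 by apply/eqP; rewrite eqn_leq lSm ml.
  have := @nth_leavesr l r 0 (ltn0Sn _); rewrite addn0 Sm => first_r.
  move: p0 p1; rewrite nth_leavesl // first_r.
  case: p => [|[] p] // [/(root_leaf ml) lE] [/(root_leaf (ltn0Sn _)) rE].
  by move: Sm; rewrite exposedE lE rE => -[<-].
move: p0 p1; rewrite !nth_leavesl //.
case: p => [|[] p] // [p0] [p1].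
have l_m := IHl _ _ Sml p0 p1.
by rewrite exposedE l_m; case: (l) l_m.
Qed.

(** Some child of [t] has more carets than the matching child of [u]; descend there until [u] is a
    leaf, where any sibling leaves of [t] will do. *)
Lemma leaf_above_siblings t u : ncarets u < ncarets t -> exists n p m,
  [/\ n < nleaves u, m.+1 < nleaves t,
    nth [::] (leaves t) m = nth [::] (leaves u) n ++ rcons p false
    & nth [::] (leaves t) m.+1 = nth [::] (leaves u) n ++ rcons p true].
Proof.
elim: t u => // l IHl r IHr [|l' r'] /= lt_ut.
  by have [p [m [mt p0 p1]]] := @leaf_siblings (Caret l r) isT; exists 0, p, m.
have [ltl | gel] := ltnP (ncarets l') (ncarets l).
  have [n [p [m [nl' ml p0 p1]]]] := IHl _ ltl.
  exists n, p, m; rewrite !nth_leavesl ?(ltnW ml) // p0 p1 !nleaves_Caret.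
  by rewrite !ltn_addr.
have [|n [p [m [nr' mr p0 p1]]]] := IHr r'; first by lia.
exists (nleaves l' + n), p, (nleaves l + m).
rewrite -(addnS _ m) !nth_leavesr ?(ltnW mr) // p0 p1 !nleaves_Caret.
by rewrite !ltn_add2l.
Qed.

Lemma rep_min_ncarets (D : tree_pair) g t u : reduced D ->
  rep g (tminus D) (tplus D) -> rep g t u -> 0 < ncarets t ->
  ncarets (tminus D) <= ncarets t.
Proof.
move=> Dred gD gtu t_gt0; rewrite leqNgt; apply/negP => lt_tD.
(* The guard in [reduced] asks for more than one caret, hence the assumption that [t] is not a
   leaf. *)
apply: Dred; first exact: leq_ltn_trans lt_tD.
have [n [p [m [nt mD p0 p1]]]] := leaf_above_siblings lt_tD.
have gn := rep_nth gtu nt.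
(* Since [g] keeps the bits after the address of leaf [n], the images of the siblings again differ
   only in the last bit. *)
have image k b : k < nleaves (tminus D) ->
    nth [::] (leaves (tminus D)) k = nth [::] (leaves t) n ++ rcons p b ->
  nth [::] (leaves (tplus D)) k = rcons (nth [::] (leaves u) n ++ p) b.
  move=> kD kE; apply: scat_inj.
  by rewrite -(rep_nth gD kD) kE rcons_cat !scat_cat -gn.
exists m; split.
  apply: (@leaf_siblings_exposed _ _ (nth [::] (leaves t) n ++ p)) => //.
    by rewrite p0 rcons_cat.
  by rewrite p1 rcons_cat.
apply: leaf_siblings_exposed (image _ _ (ltnW mD) p0) (image _ _ mD p1).
by rewrite /nleaves -tree_pair_carets.
Qed.

(** * The normal form word and the tree pair that it realizes *)

Fixpoint pos_word (k : nat) (e : seq nat) : thompsonF :=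
  if e is d :: e' then (xF k ^+ d * pos_word k.+1 e')%g else 1%g.

Lemma pos_word_cat k e f :
  pos_word k (e ++ f) = (pos_word k e * pos_word (k + size e) f)%g.
Proof.
elim: e k => [|d e IHe] k /=; first by rewrite mul1g addn0.
by rewrite IHe mulgA addnS addSn.
Qed.

Lemma size_inner_exponents d t : size (inner_exponents d t) = nleaves t.
Proof.
by elim: t d => // l IHl r IHr d; rewrite nleaves_Caret /= size_cat IHl IHr.
Qed.

Lemma size_exponents t : size (exponents t) = nleaves t.
Proof.
by elim: t => // l _ r IHr; rewrite nleaves_Caret /= size_cat size_inner_exponents IHr.
Qed.

(** The left path above the root of [t] lengthens only the path of its leftmost leaf, whose
    generator comes first. *)
Lemma pos_word_inner k d t :
  pos_word k (inner_exponents d t) =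
  (xF k ^+ d * pos_word k (inner_exponents 0 t))%g.
Proof.
elim: t d => [|l IHl r IHr] d //=; first by rewrite expg0 !mulg1.
by rewrite !pos_word_cat (IHl d.+1) (IHl 1) !size_inner_exponents expg1 expgSr !mulgA.
Qed.

Lemma act_expS k d : act (xF k.+1 ^+ d)%g = on_right (act (xF k ^+ d)%g).
Proof.
elim: d => [|d IHd]; first by rewrite !expg0 act1 on_right_id.
by rewrite !expgS !actM IHd on_right_comp !act_x.
Qed.

Lemma act_pos_word k e : act (pos_word k e) = iter k on_right (act (pos_word 0 e)).
Proof.
elim: k e => // k IHk e; rewrite iterS -IHk.
elim: e k {IHk} => [|d e IHe] k /=; first by rewrite act1 on_right_id.
by rewrite !actM on_right_comp act_expS IHe.
Qed.

Lemma graft_left l u : graft (nleaves l) (Caret l Leaf) u = Caret l u.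
Proof. by rewrite /= ltnn. Qed.

(** For [Caret l r], the factors act from right to left: that of [r] builds [r] at the end of the
    spine, that of [l] then gives [Caret l (Caret r Leaf)], and the extra [x_0] from the left edge
    above [l] rotates this into place. *)
Lemma rep_inner t :
  rep (act (pos_word 0 (inner_exponents 0 t))) (spine (nleaves t)) (Caret t Leaf).
Proof.
elim: t => [|l IHl r IHr]; first by rewrite /= expg0 mulg1 act1.
rewrite [inner_exponents _ _]/= pos_word_cat pos_word_inner.
rewrite size_inner_exponents !actM expg1 act_x.
rewrite add0n (act_pos_word (nleaves l)) nleaves_Caret -graft_spine.
apply: rep_comp; first exact: rep_iter_on_right IHr.
apply: (rep_comp (u := Caret l (Caret r Leaf))); last exact: rep_rot0.
rewrite -(graft_left l (Caret r Leaf)); apply: rep_graft IHl.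
by rewrite /nleaves ncarets_spine.
Qed.

(** As for [rep_inner], but without rotation, since a left edge that reaches the right side is not
    counted. *)
Lemma rep_exponents t : rep (act (pos_word 0 (exponents t))) (spine (ncarets t)) t.
Proof.
elim: t => [|l _ r IHr]; first by rewrite /= expg0 mulg1 act1.
rewrite [exponents _]/= pos_word_cat size_inner_exponents actM.
rewrite add0n (act_pos_word (nleaves l)) [ncarets _]/= -addSn -graft_spine.
apply: rep_comp; first exact: rep_iter_on_right IHr.
rewrite -[Caret l r]graft_left; apply: rep_graft (rep_inner l).
by rewrite /nleaves ncarets_spine.
Qed.

Lemma pos_wordE k e :
  pos_word k e = (\prod_(i <- iota k (size e)) (xF i ^+ nth 0 e (i - k)))%g.
Proof.
elim: e k => [|d e IHe] k /=; first by rewrite big_nil.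
rewrite big_cons subnn IHe; congr (_ * _)%g.
apply: eq_big_seq => i; rewrite mem_iota => /andP[ki _].
by rewrite -[i - k]prednK ?subn_gt0 // -subnS.
Qed.

Lemma prod_inv_rev (I : Type) (F : I -> thompsonF) s :
  (\prod_(i <- rev s) (F i)^-1)%g = ((\prod_(i <- s) F i)^-1)%g.
Proof.
elim: s => [|i s IHs]; first by rewrite !big_nil invg1.
by rewrite rev_cons big_rcons big_cons IHs invgM.
Qed.

Lemma pair_eltE D :
  pair_elt D = (pos_word 0 (exponents (tplus D)) / pos_word 0 (exponents (tminus D)))%g.
Proof.
rewrite /pair_elt prod_inv_rev !pos_wordE !size_exponents.
rewrite /nleaves -tree_pair_carets.
by congr (_ * _^-1)%g; apply: eq_bigr => k _; rewrite subn0.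
Qed.

Lemma rep_pair_elt D : rep (act (pair_elt D)) (tminus D) (tplus D).
Proof.
rewrite pair_eltE actM; apply: rep_comp.
  exact: rep_cancel (actK _) (rep_exponents _).
by rewrite tree_pair_carets; apply: rep_exponents.
Qed.

(** * Word lengths and the two bounds *)

Lemma word_length_le w n : is_word01 w n -> word_length w <= n.
Proof.
by move=> wn; rewrite /word_length; case: ex_minnP => m _; apply; apply/asboolP.
Qed.

Lemma word_lengthP w : is_word01 w (word_length w).
Proof. by rewrite /word_length; case: ex_minnP => m /asboolP. Qed.

Lemma is_word01_mul v w m n :
  is_word01 v m -> is_word01 w n -> is_word01 (v * w)%g (m + n).
Proof.
move=> [s [<- gs ->]] [t [<- gt ->]]; exists (s ++ t).
rewrite size_cat big_cat; split=> // g.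
by rewrite mem_cat => /orP[/gs | /gt].
Qed.

Lemma is_word01_1 : is_word01 1%g 0.
Proof. by exists [::]; rewrite big_nil. Qed.

Lemma is_word01_gen g : g \in gens01 -> is_word01 g 1.
Proof.
by move=> gg; exists [:: g]; rewrite big_seq1; split=> // h; rewrite inE => /eqP->.
Qed.

Lemma is_word01_exp g n : g \in gens01 -> is_word01 (g ^+ n)%g n.
Proof.
move=> gg; elim: n => [|n IHn]; first by rewrite expg0; apply: is_word01_1.
by rewrite expgS -add1n; apply: is_word01_mul => //; apply: is_word01_gen.
Qed.

Lemma is_word01_inv w n : is_word01 w n -> is_word01 w^-1%g n.
Proof.
move=> [s [<- gs ->]]; exists (rev (map inv s)).
rewrite size_rev size_map -prod_inv_rev; split=> //.
  move=> g; rewrite mem_rev => /mapP[h /gs + ->]; rewrite !inE.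
  by case/or4P=> /eqP->; rewrite ?invgK eqxx ?orbT.
by rewrite -map_rev big_map.
Qed.

Lemma x0_in_gens01 : xF 0 \in gens01. Proof. by rewrite inE eqxx. Qed.
Lemma x0V_in_gens01 : (xF 0)^-1%g \in gens01. Proof. by rewrite !inE eqxx orbT. Qed.
Lemma x1_in_gens01 : xF 1 \in gens01. Proof. by rewrite !inE eqxx !orbT. Qed.

Lemma pos_word_shift k e : 0 < k ->
  pos_word k.+1 e = ((xF 0)^-1 * pos_word k e * xF 0)%g.
Proof.
elim: e k => [|d e IHe] k k_gt0 /=; first by rewrite mulg1 mulVg.
have expS : (xF k.+1 ^+ d = (xF 0)^-1 * xF k ^+ d * xF 0)%g.
  elim: d => [|d IHd]; first by rewrite !expg0 mulg1 mulVg.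
  by rewrite !expgS IHd -(xF_rel k_gt0) !mulgA mulgK.
by rewrite IHe // expS !mulgA mulgK.
Qed.

(** Each index shift conjugates by [x_0]: its inverse adds one letter to [v], while the right
    factors collect into the final power. *)
Lemma pos_word1_bound d e : exists2 v, is_word01 v (d + sumn e + size e)
  & pos_word 1 (d :: e) = (v * xF 0 ^+ size e)%g.
Proof.
elim: e d => [|c e IHe] d.
  exists (xF 1 ^+ d)%g; last by rewrite /= expg0.
  by rewrite !addn0; apply: is_word01_exp x1_in_gens01.
have [v v_word vE] := IHe c.
exists (xF 1 ^+ d * ((xF 0)^-1 * v))%g.
  have -> : d + sumn (c :: e) + size (c :: e) = d + (1 + (c + sumn e + size e)).
    by rewrite /=; lia.
  apply: is_word01_mul; first exact: is_word01_exp x1_in_gens01.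
  by apply: is_word01_mul => //; apply: is_word01_gen x0V_in_gens01.
rewrite -[LHS]/(xF 1 ^+ d * pos_word 2 (c :: e))%g pos_word_shift // vE.
by rewrite /= expgSr !mulgA.
Qed.

Lemma pos_word_bound d e : 0 < size e ->
  exists2 v, is_word01 v (d + sumn e + (size e).-1)
  & pos_word 0 (d :: e) = (v * xF 0 ^+ (size e).-1)%g.
Proof.
case: e => // c e _; have [v v_word vE] := pos_word1_bound c e.
exists (xF 0 ^+ d * v)%g.
  have -> : d + sumn (c :: e) + (size (c :: e)).-1 = d + (c + sumn e + size e).
    by rewrite /=; lia.
  by apply: is_word01_mul => //; apply: is_word01_exp x0_in_gens01.
by rewrite -[LHS]/(xF 0 ^+ d * pos_word 1 (c :: e))%g vE mulgA.
Qed.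

(** Each caret has one left edge, counted at the single leaf where its left path ends. *)
Lemma sumn_inner_exponents d t : sumn (inner_exponents d t) = d + ncarets t.
Proof.
elim: t d => [|l IHl r IHr] d //=.
by rewrite sumn_cat IHl IHr; lia.
Qed.

(** Carets on the right side contribute nothing, and the root, if it is a caret, is one of them. *)
Lemma sumn_exponents t : sumn (exponents t) <= (ncarets t).-1.
Proof.
elim: t => // l _ r IHr; rewrite /= sumn_cat sumn_inner_exponents.
by rewrite (leq_trans (leq_add (leqnn _) IHr)) // add0n; lia.
Qed.

Lemma exponents_bound t : 0 < ncarets t ->
  exists2 v, is_word01 v (sumn (exponents t) + (ncarets t).-1)
  & pos_word 0 (exponents t) = (v * xF 0 ^+ (ncarets t).-1)%g.
Proof.
move=> t_gt0; have := size_exponents t.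
case: (exponents t) => // d e [sz_e]; rewrite -sz_e.
by apply: pos_word_bound; rewrite sz_e.
Qed.

Lemma word_length_pair_elt D : word_length (pair_elt D) <= 4 * pair_carets D - 4.
Proof.
have mE := tree_pair_carets D; have m_gt0 := tminus_gt0 D.
have [v v_word vE] := exponents_bound m_gt0.
have [|u u_word uE] := @exponents_bound (tplus D); first by rewrite -mE.
have := is_word01_mul u_word (is_word01_inv v_word).
have -> : (u * v^-1)%g = pair_elt D.
  by rewrite pair_eltE uE vE invgM mE mulgA mulgK.
move=> /word_length_le /leq_trans; apply.
(* With N carets, each half costs at most N - 1 letters for its exponents and N - 1 for its
   shifts. *)
have := sumn_exponents (tminus D); have := sumn_exponents (tplus D).
by rewrite /pair_carets -mE; lia.
Qed.

Lemma word_length_ge D : reduced D -> pair_carets D <= word_length (pair_elt D) + 2.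
Proof.
move=> Dred; have [ws [<- gens wE]] := word_lengthP (pair_elt D).
have [t [a [b [c [abc tn]]]]] := rep_ncarets_growth gens.
apply: leq_trans tn; apply: rep_min_ncarets Dred (rep_pair_elt D) _ _.
  by rewrite wE; exact: abc.
by rewrite (rep_nleaves abc).
Qed.

End Thompson.

(* The bounds are stated in [int], since N - 2 = -1 for the identity. *)
Theorem theorem3p1 (w : thompsonF) (D : tree_pair)
    (Dred : reduced D) (Dw : pair_elt D = w) :
  ((pair_carets D)%:Z - 2 <= (word_length w)%:Z <= 4 * (pair_carets D)%:Z - 4)%R.
Proof.
rewrite -Dw; have lower := word_length_ge Dred.
have upper := word_length_pair_elt D; have := tminus_gt0 D.
by rewrite -[ncarets _]/(pair_carets D); lia.
Qed.
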